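(* Let $A\in\mathbb{C}^{n\times n}$, let $k\ge1$, let $\lambda_0$ be an eigenvalue of $A$ having algebraic multiplicity $2k+1$ and geometric multiplicity $1$, and let $\{u_i\}_{i=1}^{2k+1}$ and $\{v_i\}_{i=1}^{2k+1}$ be left and right Jordan chains of $A$ for $\lambda_0$. Define the $n\times k$ matrices $$U:=\begin{bmatrix}u_1&u_2&\cdots&u_k\end{bmatrix},\qquad V:=\begin{bmatrix}v_1&v_2&\cdots&v_k\end{bmatrix}$$ and the vector $r=\dfrac{u_{k+1}}{v_{k+1}^*u_{k+1}}$. Let $R,L\in\mathbb{C}^{n\times k}$ be matrices satisfying $R^*V=U^*L=I_k$. Then for any $\lambda_1\in\mathbb{C}$ the matrix $$\widehat{A}:=A+(\lambda_1-\lambda_0)R_1R_2^*,\qquad R_1:=\begin{bmatrix}V&v_{k+1}&L\end{bmatrix},\quad R_2:=\begin{bmatrix}R&r&U\end{bmatrix},$$ has the following properties: (a) The eigenvalues of $\widehat{A}$ (counted with algebraic multiplicity) consist of those of $A$, except that the eigenvalue $\lambda_0$ of $A$ (with its $2k+1$ copies) is replaced by $\lambda_1$. (b) $\widehat{A}v_1=\lambda_1v_1$, $u_1^*\widehat{A}=\lambda_1u_1^*$, and $\widehat{A}v_{i+1}=\lambda_1v_{i+1}+v_i$, $u_{i+1}^*\widehat{A}=\lambda_1u_{i+1}^*+u_i^*$ for $i=1,\ldots,k-1$. That is, $\widehat{A}V=VJ_k(\lambda_1)$ and $U^*\widehat{A}=J_k^\top(\lambda_1)U^*$.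
   Context: $^*$ denotes conjugate transpose. $J_k(\lambda)$ is the $k\times k$ Jordan block with $\lambda$ on the diagonal and $1$ on the superdiagonal. A right Jordan chain $\{v_i\}_{i=1}^{m}$ of $A$ for $\lambda_0$ satisfies $v_1\neq0$, $Av_1=\lambda_0v_1$ and $Av_{i+1}=\lambda_0v_{i+1}+v_i$ for $1\le i<m$. A left Jordan chain $\{u_i\}_{i=1}^{m}$ satisfies $u_1\ne0$, $u_1^*A=\lambda_0u_1^*$ and $u_{i+1}^*A=\lambda_0u_{i+1}^*+u_i^*$ for $1\le i<m$. Under the stated hypotheses $v_{k+1}^*u_{k+1}\neq0$, so $r$ is well defined. *)

(* Defs.v *)
(* The theorem takes the complex numbers to be K[i] for K : realType. *)
From HB Require Import structures.
From mathcomp Require Import all_boot all_order all_algebra.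
From mathcomp Require Import spectral complex reals.

Set Implicit Arguments.
Unset Strict Implicit.
Unset Printing Implicit Defensive.

Import Order.TTheory GRing.Theory Num.Theory.

Local Open Scope ring_scope.
Local Open Scope sesquilinear_scope.

Section Definitions.
Variable C : numClosedFieldType.

Definition alg_mult (n : nat) (A : 'M[C]_n) (a : C) : nat :=
  mup a (char_poly A).

(* MathComp eigenspaces consist of row vectors; transposing A gives the
   dimension of {x : 'cV_n | A *m x = a *: x}. *)
Definition geom_mult (n : nat) (A : 'M[C]_n) (a : C) : nat :=
  \rank (eigenspace A^T a).

(* The roots of the characteristic polynomial, repeated according to their
   multiplicity; only meaningful up to perm_eq. *)
Definition eigenvalues (n : nat) (A : 'M[C]_n) : seq C :=
  sval (closed_field_poly_normal (char_poly A)).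

Lemma eigenvaluesP (n : nat) (A : 'M[C]_n) :
  char_poly A = \prod_(z <- eigenvalues A) ('X - z%:P).
Proof.
rewrite /eigenvalues; case: closed_field_poly_normal => s /= {1}->.
by rewrite (monicP (char_poly_monic A)) scale1r.
Qed.

Definition jordan_block (k : nat) (a : C) : 'M[C]_k :=
  \matrix_(i, j) (if i == j then a else (j == i.+1 :> nat)%:R).

(* Chains are indexed from 1, as in v_1, ..., v_m; the values of v outside
   [1, m] are irrelevant. *)
Definition right_jordan_chain (n : nat) (A : 'M[C]_n) (a : C) (m : nat)
    (v : nat -> 'cV[C]_n) : Prop :=
  [/\ v 1%N != 0, A *m v 1%N = a *: v 1%N &
      forall i : nat, (1 <= i < m)%N -> A *m v i.+1 = a *: v i.+1 + v i].

Definition left_jordan_chain (n : nat) (A : 'M[C]_n) (a : C) (m : nat)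
    (u : nat -> 'cV[C]_n) : Prop :=
  [/\ u 1%N != 0, (u 1%N)^t* *m A = a *: (u 1%N)^t* &
      forall i : nat, (1 <= i < m)%N ->
        (u i.+1)^t* *m A = a *: (u i.+1)^t* + (u i)^t*].

(* The n x k matrix [w_1 w_2 ... w_k]. *)
Definition cols (n k : nat) (w : nat -> 'cV[C]_n) : 'M[C]_(n, k) :=
  \matrix_(i < n, j < k) w j.+1 i 0.

End Definitions.

(* Main.v *)
(* If A W = W M, then A + W D has the characteristic polynomial of A with that
   of M replaced by that of M + D W. Pairing the two Jordan chains gives
   u_i^* v_j = 0 for i + j <= 2k + 1, while u_(k+1)^* v_(k+1) <> 0, since otherwise
   the right chain could be extended beyond the algebraic multiplicity. So the
   principle applies first to the invariant subspace spanned by v_1, ..., v_(k+1),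
   then, on the left, to the one spanned by u_1, ..., u_k. Throughout, w_i is the
   entrywise conjugate of u_i, which turns the left chain of A into a right chain
   of its transpose. *)
Require Import Defs.
From HB Require Import structures.
From mathcomp Require Import all_boot all_order all_algebra.
From mathcomp Require Import spectral complex reals.

Set Implicit Arguments.
Unset Strict Implicit.
Unset Printing Implicit Defensive.

Import Order.TTheory GRing.Theory Num.Theory.

Local Open Scope ring_scope.
Local Open Scope sesquilinear_scope.
Local Open Scope complex_scope.

(* Both sides are the determinant of [[G, W H], [D, H]], expanded by columns. *)
Lemma det_sub_intertwine (R : comPzRingType) (n p : nat) (G : 'M[R]_n)
    (H : 'M[R]_p) (W : 'M[R]_(n, p)) (D : 'M[R]_(p, n)) :
  G *m W = W *m H -> \det (G - W *m D) * \det H = \det G * \det (H - D *m W).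
Proof.
move=> GW.
have -> : \det (G - W *m D) * \det H = \det (block_mx G (W *m H) D H).
  have -> : block_mx G (W *m H) D H = block_mx (G - W *m D) W 0 1%:M
              *m block_mx 1%:M 0 D 1%:M *m block_mx 1%:M 0 0 H.
    by rewrite !mulmx_block !(mulmx1, mul1mx, mulmx0, mul0mx, addr0, add0r) subrK.
  by rewrite !det_mulmx !det_ublock det_lblock !det1 !mulr1 !mul1r.
have -> : block_mx G (W *m H) D H =
    block_mx G 0 D (H - D *m W) *m block_mx 1%:M W 0 1%:M.
  by rewrite !mulmx_block !(mulmx1, mulmx0, addr0, add0r) GW addrC subrK.
by rewrite det_mulmx det_lblock det_ublock !det1 !mulr1.
Qed.

(** This is the determinant identity for [G] = X - A and [H] = X - M, which intertwine through [W]
    because A and M do. *)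
Lemma char_poly_add_intertwine (R : comNzRingType) (n p : nat) (A : 'M[R]_n)
    (M : 'M[R]_p) (W : 'M[R]_(n, p)) (D : 'M[R]_(p, n)) :
  A *m W = W *m M ->
  char_poly (A + W *m D) * char_poly M = char_poly A * char_poly (M + D *m W).
Proof.
move=> AW; rewrite /char_poly /char_poly_mx !map_mxD !map_mxM !opprD !addrA.
apply: det_sub_intertwine.
by rewrite mulmxBl mulmxBr scalar_mxC -!map_mxM AW.
Qed.

Lemma char_poly_tr (R : comNzRingType) (n : nat) (A : 'M[R]_n) :
  char_poly A^T = char_poly A.
Proof.
rewrite /char_poly -[RHS]det_tr; congr (\det _).
by rewrite /char_poly_mx linearB /= tr_scalar_mx map_trmx.
Qed.

(** * Jordan blocks and Jordan chains *)

Section JordanChains.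
Variable C : numClosedFieldType.

Lemma jordan_block_trig (k : nat) (a : C) : is_trig_mx (jordan_block k a)^T.
Proof.
apply/is_trig_mxP => i j ij; rewrite !mxE -val_eqE /= (gtn_eqF ij).
by rewrite ltn_eqF // ltnW.
Qed.

Lemma char_poly_jordan_block (k : nat) (a : C) :
  char_poly (jordan_block k a) = ('X - a%:P) ^+ k.
Proof.
rewrite -char_poly_tr (char_poly_trig (jordan_block_trig k a)).
by under eq_bigr do rewrite !mxE eqxx; rewrite prodr_const card_ord.
Qed.

Lemma jordan_block_add_scalar (k : nat) (a b : C) :
  jordan_block k a + b%:M = jordan_block k (a + b).
Proof.
apply/matrixP => i j; rewrite !mxE; case: eqP => _; by rewrite ?mulr1n ?mulr0n ?addr0.
Qed.

Lemma mul_cols (n k : nat) (v : nat -> 'cV[C]_n) (x : 'cV[C]_k) :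
  cols k v *m x = \sum_(i < k) x i 0 *: v i.+1.
Proof.
apply/colP => i; rewrite !mxE summxE.
by apply: eq_bigr => j _; rewrite !mxE mulrC.
Qed.

Lemma col_cols (n k : nat) (v : nat -> 'cV[C]_n) (j : 'I_k) :
  col j (cols k v) = v j.+1.
Proof. by apply/colP => i; rewrite !mxE. Qed.

Lemma mulmx_cols_col (n k : nat) (v : nat -> 'cV[C]_n) (B : 'M[C]_n) (c : C) (i : nat) :
  B *m cols k v = c *: cols k v -> (1 <= i <= k)%N -> B *m v i = c *: v i.
Proof.
case: i => // i BV ik; rewrite -(col_cols v (Ordinal ik)) colE mulmxA BV.
by rewrite scalemxAl.
Qed.

Lemma cols_add1 (n k : nat) (v : nat -> 'cV[C]_n) :
  cols (k + 1) v = row_mx (cols k v) (v k.+1).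
Proof.
apply/matrixP => i j; rewrite !mxE; case: splitP => l jl; rewrite ?mxE ?jl //.
by rewrite ord1 addn0.
Qed.

Section RightChain.
Variables (n m : nat) (A : 'M[C]_n) (a : C) (v : nat -> 'cV[C]_n).
Hypothesis chainv : right_jordan_chain A a m v.

Lemma chain_mul_cols (k : nat) : (k <= m)%N ->
  A *m cols k v = cols k v *m jordan_block k a.
Proof.
case: chainv => _ Av1 AvS km; apply/matrixP => i j.
have -> : (A *m cols k v) i j = (A *m v j.+1) i 0.
  by rewrite -(col_cols v j) colE mulmxA -colE [RHS]mxE.
(* Off the diagonal, column [j] of the block has a single 1, in row j - 1, and none when j = 0; this
   separates v_1 from the recursion. *)
have -> : (cols k v *m jordan_block k a) i j =
    a * v j.+1 i 0 + \sum_(l < k | l != j) v l.+1 i 0 * (j == l.+1 :> nat)%:R.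
  rewrite !mxE (bigD1 j) //= !mxE eqxx mulrC; congr (_ + _).
  by apply: eq_bigr => l /negbTE lj; rewrite !mxE lj.
case: j => [[|j] jk] /=.
  by rewrite Av1 mxE big1 ?addr0 // => l _; rewrite mulr0.
have lt_jk := ltnW jk.
rewrite AvS ?(leq_trans jk) // !mxE; congr (_ + _).
rewrite (bigD1 (Ordinal lt_jk)) /= ?eqxx ?mulr1; last first.
  by rewrite -val_eqE /= ltn_eqF.
rewrite big1 ?addr0 // => l /andP [_ lj].
by rewrite eqSS eq_sym -[j]/(val (Ordinal lt_jk)) val_eqE (negbTE lj) mulr0.
Qed.

(** Induction on [k]: A - a kills v_1 and lowers every other index by one, so all coefficients but
    the first vanish; then v_1 <> 0 disposes of the first. *)
Lemma chain_free (k : nat) (x : nat -> C) : (k <= m)%N ->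
  \sum_(i < k) x i *: v i.+1 = 0 -> forall i, (i < k)%N -> x i = 0.
Proof.
case: chainv => v1N0 Av1 AvS; elim: k x => [//|k IHk] x km sum0.
have xS i : (i < k)%N -> x i.+1 = 0.
  apply: (IHk (fun i => x i.+1) (ltnW km)).
  have := congr1 (mulmx (A - a%:M)) sum0.
  rewrite mulmx0 mulmx_sumr big_ord_recl -scalemxAr mulmxBl Av1 mul_scalar_mx.
  rewrite subrr scaler0 add0r => E; rewrite -[RHS]E; apply: eq_bigr => j _.
  have jm : (1 <= bump 0 j < m)%N by rewrite /= (leq_trans _ km) // ltnS ltn_ord.
  by rewrite -scalemxAr mulmxBl mul_scalar_mx AvS // addrAC subrr add0r.
case=> [_|i]; last exact: xS.
move: sum0; rewrite big_ord_recl big1 ?addr0 => [/eqP|j _].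
  by rewrite scaler_eq0 (negbTE v1N0) orbF => /eqP.
by rewrite xS ?scale0r.
Qed.

Lemma chain_left_inverse : exists P : 'M[C]_(m, n), P *m cols m v = 1%:M.
Proof.
have free : row_free (cols m v)^T.
  apply: inj_row_free => x /(congr1 trmx); rewrite trmx_mul trmxK trmx0 mul_cols.
  move=> sum0; apply/rowP => i; rewrite mxE.
  (* The coefficients are extended by 0 to all naturals, the form in which [chain_free] can shift
     them. *)
  pose y j := if insub j is Some l then x 0 l else 0.
  have yE (j : 'I_m) : y j = x 0 j by rewrite /y valK.
  rewrite -yE (@chain_free m y) // -[RHS]sum0.
  by apply: eq_bigr => j _; rewrite yE mxE.
exists (pinvmx (cols m v)^T)^T.
by apply: trmx_inj; rewrite trmx_mul trmxK mulmxVp // trmx1.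
Qed.

(* Adding V P, with P V = 1, moves the m copies of a carried by the chain to
   a + 1; so the characteristic polynomial of A has at least m such copies. *)
Lemma chain_alg_mult : (m <= alg_mult A a)%N.
Proof.
have [P PV] := chain_left_inverse.
have := char_poly_add_intertwine P (chain_mul_cols (leqnn m)).
rewrite PV jordan_block_add_scalar !char_poly_jordan_block => /(congr1 (mup a)).
rewrite mupM ?monic_neq0 ?char_poly_monic ?monic_exp ?monicXsubC //.
rewrite mupMl; last first.
  rewrite rootE horner_exp hornerXsubC expf_neq0 //.
  by rewrite opprD addrA subrr sub0r oppr_eq0 oner_eq0.
by rewrite mup_XsubCX eqxx /alg_mult => <-; rewrite leq_addl.
Qed.

Lemma chain_add (B : 'M[C]_n) (c : C) (k : nat) : (1 <= k <= m)%N ->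
  B *m cols k v = c *: cols k v ->
  right_jordan_chain (A + B) (a + c) k v.
Proof.
case: chainv => v1N0 Av1 AvS /andP [k1 km] /mulmx_cols_col Bv; split=> //.
  by rewrite mulmxDl Av1 Bv ?scalerDl ?k1.
move=> i /andP [i1 ik]; rewrite mulmxDl Bv ?ik // AvS ?scalerDl 1?addrAC //.
by rewrite i1 (leq_trans ik).
Qed.

Lemma chain_rcons (x : 'cV[C]_n) : (1 <= m)%N -> A *m x = a *: x + v m ->
  right_jordan_chain A a m.+1 (fun i => if i == m.+1 then x else v i).
Proof.
case: chainv => v1N0 Av1 AvS m1 Ax.
have mN1 : (1%N == m.+1) = false by rewrite eqSS eq_sym -leqn0 leqNgt m1.
split; rewrite ?mN1 // => i /andP [i1]; rewrite ltnS leq_eqVlt eqSS.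
case: eqP => [-> _|_ /= im]; first by rewrite ltn_eqF.
by rewrite ltn_eqF ?AvS ?i1 // ltnW.
Qed.

End RightChain.

(** * Pairing of left and right chains *)

Section Pairing.
Variables (n m : nat) (A : 'M[C]_n) (a : C) (w v : nat -> 'cV[C]_n).
Hypothesis chainw : right_jordan_chain A^T a m w.
Hypothesis chainv : right_jordan_chain A a m v.

(** Evaluating w_(i+1)^T A v_(j+1) from the left and from the right gives two expressions whose
    terms in [a] cancel. *)
Lemma chain_pairing_shift (i j : nat) : (1 <= i < m)%N -> (1 <= j < m)%N ->
  (w i.+1)^T *m v j = (w i)^T *m v j.+1.
Proof.
case: chainw chainv => _ _ AwS [_ _ AvS] im jm.
have := congr1 (fun x => x^T *m v j.+1) (AwS i im).
rewrite trmx_mul trmxK -mulmxA AvS // mulmxDr -scalemxAr linearD /=.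
by rewrite [(a *: _)^T]linearZ /= mulmxDl -scalemxAl => /addrI.
Qed.

(** Shifting lowers i at constant i + j, down to i = 1; there w_1^T A v_(j+1), computed from both
    sides, leaves w_1^T v_j = 0. *)
Lemma chain_pairing_eq0 (i j : nat) : (1 <= i)%N -> (1 <= j)%N ->
  (i + j <= m)%N -> (w i)^T *m v j = 0.
Proof.
elim: i j => [//|[_|i IHi]] j _ j1 ijm.
  case: chainw chainv => _ Aw1 _ [_ _ AvS].
  have := congr1 (fun x => x^T *m v j.+1) Aw1.
  rewrite trmx_mul trmxK -mulmxA AvS ?j1 // mulmxDr -scalemxAr.
  by rewrite [(a *: _)^T]linearZ /= -scalemxAl -[RHS]addr0 => /addrI.
rewrite chain_pairing_shift ?j1 /=.
- by apply: IHi => //; rewrite addnS -addSn.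
- by rewrite (leq_trans _ ijm) // leq_addr.
- by rewrite (leq_trans _ ijm) // addSn ltnS leq_addl.
Qed.

(** Repeated shifting carries the middle pairing w_(k+1)^T v_(k+1) to w_1^T v_(2k+1), where the
    extension argument applies. *)
Lemma chain_pairing_first (i j : nat) : (1 <= j)%N -> (i + j <= m)%N ->
  (w i.+1)^T *m v j = (w 1%N)^T *m v (i + j)%N.
Proof.
elim: i j => [//|i IHi] j j1 ijm.
rewrite chain_pairing_shift ?IHi ?addnS // -?addSn ?j1 //=.
  by rewrite (leq_trans _ ijm) // -[X in (X < _)%N]addn0 ltn_add2l.
by rewrite (leq_trans _ ijm) // addSn ltnS leq_addl.
Qed.

(* Otherwise v m would be orthogonal to the left kernel of A - a, which w 1
   spans, hence lie in the range of A - a, and the chain could be extended. *)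
Lemma chain_pairing_last_neq0 : (1 <= m)%N -> alg_mult A a = m ->
  geom_mult A a = 1%N -> (w 1%N)^T *m v m != 0.
Proof.
move=> m1 multA geomA; apply/negP => /eqP wv0.
case: (chainw) => w1N0 Aw1 _.
suff [x Nx] : exists x, (A - a%:M) *m x = v m.
  have Ax : A *m x = a *: x + v m by rewrite -Nx mulmxBl mul_scalar_mx addrC subrK.
  by have := chain_alg_mult (chain_rcons chainv m1 Ax); rewrite multA ltnn.
(* The kernels of A - a and of its transpose have equal dimension, here 1, so the nonzero vector w_1
   spans the left one. *)
have ker_w : (kermx (A - a%:M) <= (w 1%N)^T)%MS.
  have wker : ((w 1%N)^T <= kermx (A - a%:M))%MS.
    rewrite sub_kermx mulmxBr -[A]trmxK -trmx_mul Aw1 linearZ /= mul_mx_scalar.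
    by rewrite subrr.
  rewrite -(geq_leqif (mxrank_leqif_sup wker)) rank_rV trmx_eq0 w1N0 /=.
  rewrite -geomA /geom_mult /eigenspace !mxrank_ker -mxrank_tr linearB /=.
  by rewrite tr_scalar_mx.
(* The cokernel, transposed, lies in the left kernel, hence consists of multiples of w_1, all
   orthogonal to v_m. *)
have : ((v m)^T <= (A - a%:M)^T)%MS.
  rewrite submxE -trmx_eq0 trmx_mul trmxK.
  have /submxP [D ->] : ((cokermx (A - a%:M)^T)^T <= (w 1%N)^T)%MS.
    apply: submx_trans ker_w; rewrite sub_kermx; apply/eqP/trmx_inj.
    by rewrite trmx_mul trmxK mulmx_coker trmx0.
  by rewrite -mulmxA wv0 mulmx0.
by move=> /submxP [D vD]; exists D^T; rewrite -[v m]trmxK vD trmx_mul !trmxK.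
Qed.

End Pairing.

End JordanChains.

(** By unique factorization, the spectrum of B with m copies of a added is that of A with m copies
    of b added; it remains to cancel the copies of a. *)
Lemma eigenvalues_perm (C : numClosedFieldType) (n m : nat) (A B : 'M[C]_n) (a b : C) :
  alg_mult A a = m ->
  char_poly B * ('X - a%:P) ^+ m = char_poly A * ('X - b%:P) ^+ m ->
  perm_eq (eigenvalues B) (nseq m b ++ [seq z <- eigenvalues A | z != a]).
Proof.
have prod_nseq c : \prod_(z <- nseq m c) ('X - z%:P) = ('X - c%:P) ^+ m :> {poly C}.
  by rewrite big_nseq iter_mulr_1.
move=> multA; rewrite !eigenvaluesP -!prod_nseq -!big_cat => /prod_XsubC_eq.
have filter_a : [seq z <- eigenvalues A | z == a] = nseq m a.
  have -> : m = count_mem a (eigenvalues A).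
    by rewrite -mu_prod_XsubC -eigenvaluesP.
  by rewrite -size_filter; apply/all_pred1P/filter_all.
rewrite -(perm_cat2r (nseq m a)) => /permPl ->.
rewrite -catA -filter_a perm_catC perm_cat2l perm_sym perm_catC.
by rewrite (perm_filterC (pred1 a)).
Qed.

Lemma block1_upper_diag (R : pzRingType) (m n : nat) (X : 'M[R]_(m, n)) (j : 'I_(m + n)) :
  block_mx 1%:M X 0 1%:M j j = 1.
Proof.
by rewrite -[j]splitK; case: (split j) => l; rewrite ?block_mxEul ?block_mxEdr mxE eqxx.
Qed.

(** * The perturbed matrix *)

Section Perturbation.
Variables (C : numClosedFieldType) (n k : nat) (A : 'M[C]_n) (a b : C).
Variables (w v : nat -> 'cV[C]_n).
Variables (P : 'M[C]_(k, n)) (s : 'rV[C]_n) (L : 'M[C]_(n, k)).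
Hypothesis chainw : right_jordan_chain A^T a (2 * k + 1) w.
Hypothesis chainv : right_jordan_chain A a (2 * k + 1) v.
Hypothesis PV : P *m cols k v = 1%:M.
Hypothesis WL : (cols k w)^T *m L = 1%:M.
Hypothesis sV : s *m cols k v = 0.
Hypothesis svS : s *m v k.+1 = 1%:M.

(** With [P] = R^* and [s] = r^* this is R_1 R_2^*, grouped so that the right and left updates can
    be made in turn. *)
Let B := cols (k + 1) v *m col_mx P s + L *m (cols k w)^T.

Lemma cols_pairing_eq0 (p q : nat) : (p + q <= 2 * k + 1)%N ->
  (cols p w)^T *m cols q v = 0.
Proof.
move=> pqk; apply/matrixP => i j.
transitivity (((w i.+1)^T *m v j.+1) 0 0).
  by rewrite !mxE; apply: eq_bigr => l _; rewrite !mxE.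
rewrite (chain_pairing_eq0 chainw chainv) ?mxE //.
exact: leq_trans (leq_add (ltn_ord i) (ltn_ord j)) pqk.
Qed.

(** Here k + (k + 1) = 2k + 1 is the largest index sum at which the pairing must vanish, so v_(k+1)
    can still join the right side. *)
Let WV : (cols k w)^T *m cols (k + 1) v = 0.
Proof. by rewrite cols_pairing_eq0 // addnA addnn mul2n. Qed.

Lemma perturb_mul_cols : B *m cols k v = cols k v.
Proof.
have WV' : (cols k w)^T *m cols k v = 0.
  by rewrite cols_pairing_eq0 // addnn mul2n leq_addr.
rewrite mulmxDl -!mulmxA mul_col_mx PV sV WV' mulmx0 addr0 cols_add1.
by rewrite mul_row_col mulmx1 mulmx0 addr0.
Qed.

Lemma perturb_tr_mul_cols : B^T *m cols k w = cols k w.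
Proof.
apply: trmx_inj; rewrite trmx_mul trmxK mulmxDr !mulmxA WV WL mul0mx.
by rewrite add0r mul1mx.
Qed.

Lemma perturb_right_chain : (1 <= k)%N ->
  right_jordan_chain (A + (b - a) *: B) b k v.
Proof.
move=> k1; rewrite -[b in X in _ X k v](subrKC a); apply: (chain_add chainv).
  by rewrite k1 mul2n -addnn -addnA leq_addr.
by rewrite -scalemxAl perturb_mul_cols.
Qed.

Lemma perturb_left_chain : (1 <= k)%N ->
  right_jordan_chain (A + (b - a) *: B)^T b k w.
Proof.
move=> k1; rewrite -[b in X in _ X k w](subrKC a) linearD /=.
apply: (chain_add chainw).
  by rewrite k1 mul2n -addnn -addnA leq_addr.
by rewrite [(_ *: B)^T]linearZ /= -scalemxAl perturb_tr_mul_cols.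
Qed.

(* The right chain moves k + 1 copies of a to b; the left chain is unaffected,
   as it annihilates the right one, and moves the remaining k copies. *)
Lemma perturb_char_poly :
  char_poly (A + (b - a) *: B) * ('X - a%:P) ^+ (2 * k + 1) =
  char_poly A * ('X - b%:P) ^+ (2 * k + 1).
Proof.
set c := b - a; set D := c *: col_mx P s; set A1 := A + cols (k + 1) v *m D.
have char1 : char_poly A1 * ('X - a%:P) ^+ (k + 1) = char_poly A * ('X - b%:P) ^+ (k + 1).
  have AV : A *m cols (k + 1) v = cols (k + 1) v *m jordan_block (k + 1) a.
    by apply: (chain_mul_cols chainv); rewrite leq_add2r mul2n -addnn leq_addr.
  have := char_poly_add_intertwine D AV; rewrite char_poly_jordan_block => ->.
  congr (_ * _).
  (* The corner [P *m v k.+1] is arbitrary but lies above the diagonal: added to the Jordan block it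
     leaves an upper triangular matrix with diagonal a + c = b. *)
  have -> : D *m cols (k + 1) v = c *: block_mx 1%:M (P *m v k.+1) 0 1%:M.
    by rewrite -scalemxAl cols_add1 mul_col_row PV sV svS.
  rewrite -char_poly_tr char_poly_trig.
    rewrite -[(_ + 1)%N in RHS]card_ord -prodr_const.
    apply: eq_bigr => i _; rewrite 2!mxE [jordan_block _ _ i i]mxE eqxx.
    by rewrite mxE block1_upper_diag mulr1 subrKC.
  rewrite linearD /= linearZ /= tr_block_mx trmx0 !trmx1.
  apply/is_trig_mxP => i j ij.
  have /is_trig_mxP J := jordan_block_trig (k + 1) a.
  have /is_trig_mxP T : is_trig_mx (block_mx 1%:M 0 (P *m v k.+1)^T 1%:M : 'M[C]_(k + 1)).
    by rewrite is_trig_block_mx // eqxx !scalar_mx_is_trig.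
  by rewrite mxE J // mxE T // mulr0 addr0.
have AW : A1^T *m cols k w = cols k w *m jordan_block k a.
  rewrite linearD mulmxDl /= -[X in _ + X]trmxK trmx_mul trmxK mulmxA WV mul0mx.
  rewrite trmx0 addr0; apply: (chain_mul_cols chainw).
  by rewrite mul2n -addnn -addnA leq_addr.
have -> : A + c *: B = A1 + (c *: L) *m (cols k w)^T.
  by rewrite /A1 /D -scalemxAr -scalemxAl -addrA -scalerDr.
have := char_poly_add_intertwine (c *: L)^T AW.
have -> : (c *: L)^T *m cols k w = c%:M.
  by rewrite -[cols k w]trmxK -trmx_mul -scalemxAr WL scale_scalar_mx mulr1 tr_scalar_mx.
rewrite jordan_block_add_scalar subrKC !char_poly_jordan_block.
have -> : A1^T + cols k w *m (c *: L)^T = (A1 + c *: L *m (cols k w)^T)^T.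
  by rewrite [RHS]linearD /= trmx_mul trmxK.
rewrite !char_poly_tr => char2.
(* The left update accounts for k of the copies, the right one for k + 1. *)
have -> : (2 * k + 1 = k + (k + 1))%N by rewrite mul2n -addnn addnA.
by rewrite !(exprD _ k (k + 1)) !mulrA char2 mulrAC char1 mulrAC.
Qed.

End Perturbation.

Theorem theorem4p1 (K : realType) (n k : nat) (A : 'M[K[i]]_n) (lambda0 : K[i])
    (u v : nat -> 'cV[K[i]]_n) (R L : 'M[K[i]]_(n, k)) :
  (1 <= k)%N ->
  eigenvalue A lambda0 ->
  alg_mult A lambda0 = (2 * k + 1)%N ->
  geom_mult A lambda0 = 1%N ->
  left_jordan_chain A lambda0 (2 * k + 1) u ->
  right_jordan_chain A lambda0 (2 * k + 1) v ->
  let U := cols k u in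
  let V := cols k v in
  let r := (((v k.+1)^t* *m u k.+1) 0 0)^-1 *: u k.+1 in
  R^t* *m V = 1%:M ->
  U^t* *m L = 1%:M ->
  forall lambda1 : K[i],
  let R1 := row_mx V (row_mx (v k.+1) L) in
  let R2 := row_mx R (row_mx r U) in
  let Ahat := A + (lambda1 - lambda0) *: (R1 *m R2^t*) in
  perm_eq (eigenvalues Ahat)
    (nseq (2 * k + 1) lambda1 ++ [seq z <- eigenvalues A | z != lambda0])
  /\
  [/\ Ahat *m v 1%N = lambda1 *: v 1%N,
      (u 1%N)^t* *m Ahat = lambda1 *: (u 1%N)^t*,
      (forall i : nat, (1 <= i < k)%N ->
         Ahat *m v i.+1 = lambda1 *: v i.+1 + v i /\
         (u i.+1)^t* *m Ahat = lambda1 *: (u i.+1)^t* + (u i)^t*),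
      Ahat *m V = V *m jordan_block k lambda1 &
      U^t* *m Ahat = (jordan_block k lambda1)^T *m U^t*].
Proof.
move=> k1 _ multA geomA [u1N0 uA uAS] chainv U V r RV UL lambda1 R1 R2 Ahat.
pose w i := ((u i)^t*)^T.
have wT i : (u i)^t* = (w i)^T by rewrite trmxK.
have chainw : right_jordan_chain A^T lambda0 (2 * k + 1) w.
  split=> [||i im]; last 1 first.
  - by rewrite -trmx_mul uAS // linearD linearZ.
  - by rewrite trmx_eq0 map_mx_eq0 trmx_eq0.
  - by rewrite -trmx_mul uA linearZ.
have UtW : U^t* = (cols k w)^T by apply/matrixP => i j; rewrite !mxE.
(* The index sum is 2k + 2, so this pairing equals w_1^T v_(2k+1), nonzero by the multiplicity
   hypotheses. *)
have wv_neq0 : ((w k.+1)^T *m v k.+1) 0 0 != 0.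
  have m1 : (1 <= 2 * k + 1)%N by rewrite addn1.
  have km : (k + k.+1 = 2 * k + 1)%N by rewrite addnS addn1 addnn mul2n.
  have := chain_pairing_last_neq0 chainw chainv m1 multA geomA.
  rewrite -km -(chain_pairing_first chainw chainv) ?km //.
  by apply: contraNneq => wv0; rewrite [X in X == _]mx11_scalar wv0 raddf0.
(* Conjugation turns the denominator v_(k+1)^* u_(k+1) into w_(k+1)^T v_(k+1). *)
have rE : r^t* = (((w k.+1)^T *m v k.+1) 0 0)^-1 *: (w k.+1)^T.
  rewrite linearZ map_mxZ fmorphV wT; congr (_^-1 *: _).
  rewrite -wT !mxE rmorph_sum; apply: eq_bigr => l _.
  by rewrite !mxE rmorphM /= conjCK mulrC.
(* Up to a scalar, r^* is the last row of the transpose of [cols k.+1 w], and (k + 1) + k = 2k + 1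
   is still in the vanishing range. *)
have rV : r^t* *m V = 0.
  have /(congr1 (row ord_max)) : (cols k.+1 w)^T *m V = 0.
    by rewrite (cols_pairing_eq0 chainw chainv) // addSn addnn mul2n addn1.
  by rewrite row_mul row0 -tr_col col_cols rE -scalemxAl => ->; rewrite scaler0.
have rvS : r^t* *m v k.+1 = 1%:M.
  by rewrite rE -scalemxAl [X in _ *: X]mx11_scalar scale_scalar_mx mulVf.
have WL : (cols k w)^T *m L = 1%:M by rewrite -UtW.
have AhatE : Ahat = A + (lambda1 - lambda0) *:
    (cols (k + 1) v *m col_mx (R^t*) (r^t*) + L *m (cols k w)^T).
  rewrite /Ahat /R1 /R2 !tr_row_mx !map_col_mx -UtW cols_add1.
  by rewrite !mul_row_col addrA.
have chainv' : right_jordan_chain Ahat lambda1 k v.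
  by rewrite AhatE; apply: (perturb_right_chain _ _ chainw chainv).
have chainw' : right_jordan_chain Ahat^T lambda1 k w.
  by rewrite AhatE; apply: (perturb_left_chain _ _ _ chainw chainv).
split.
  apply: eigenvalues_perm multA _; rewrite AhatE.
  exact: perturb_char_poly chainw chainv RV WL rV rvS.
have uE i : (u i)^t* *m Ahat = (Ahat^T *m w i)^T by rewrite trmx_mul (trmxK Ahat) wT.
case: (chainv') (chainw') => _ Av1 AvS [_ Aw1 AwS]; split=> //.
- by rewrite uE Aw1 linearZ wT.
- by move=> i im; rewrite uE AvS // AwS // linearD linearZ /= !wT.
- exact: chain_mul_cols chainv' _ (leqnn k).
- rewrite UtW -[Ahat]trmxK -!trmx_mul; congr (_^T).
  exact: chain_mul_cols chainw' _ (leqnn k).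
Qed.
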